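(* Let $n\ge 5$. If $G$ is a tricyclic graph on $n$ vertices, then $SLEE(G)\le SLEE(H_6^n)=SLEE(H_7^n)$, with equality $SLEE(G)=SLEE(H_6^n)$ if and only if either $G\cong H_6^n$ or $G\cong H_7^n$.
   Context: All graphs are finite, undirected and simple. A tricyclic graph is a connected graph with $n$ vertices and $m=n+2$ edges (cyclomatic number $m-n+1=3$). For a graph $G$ on $n$ vertices, the signless Laplacian matrix is $\mathbf{Q}(G)=\mathbf{D}(G)+\mathbf{A}(G)$, where $\mathbf{D}(G)$ is the diagonal matrix of vertex degrees and $\mathbf{A}(G)$ is the adjacency matrix. If $q_1,\dots,q_n$ are the eigenvalues of $\mathbf{Q}(G)$ (with multiplicity), then $SLEE(G)=\sum_{i=1}^n e^{q_i}$. The graph $H_6^n$ ($n\ge 5$) is obtained from the graph on vertices $z,y,a_1,a_2,a_3$ with edges $zy$, $za_i$, $ya_i$ ($i=1,2,3$) by attaching $n-5$ pendent vertices to $z$. The graph $H_7^n$ ($n\ge 4$) is obtained from the complete graph $K_4$ by attaching $n-4$ pendent vertices to one of its vertices. *)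

(* Defs.v *)
From HB Require Import structures.
From mathcomp Require Import all_boot all_order all_algebra.
From mathcomp Require Import polyrcf complex.
From mathcomp Require Import reals sequences exp.

Set Implicit Arguments.
Unset Strict Implicit.
Unset Printing Implicit Defensive.

Import Order.TTheory GRing.Theory Num.Theory.
Local Open Scope ring_scope.

Record sgraph := SGraph {
  svertex :> finType;
  sedge : rel svertex;
  sedge_sym : symmetric sedge;
  sedge_irr : irreflexive sedge }.

Definition edges (G : sgraph) : {set {set G}} :=
  [set [set p.1; p.2] | p : G * G & sedge p.1 p.2].

Definition degree (G : sgraph) (x : G) : nat := #|[set y : G | sedge x y]|.

Definition connected (G : sgraph) : Prop :=
  (0 < #|G|)%N /\ forall x y : G, connect (@sedge G) x y.

Definition tricyclic (G : sgraph) : Prop :=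
  connected G /\ #|edges G| = (#|G| + 2)%N.

Definition giso (G H : sgraph) : Prop :=
  exists f : G -> H,
    bijective f /\ forall x y : G, sedge (f x) (f y) = sedge x y.

(* Adding k new vertices (the [inr] ones), each joined to z only. *)
Section AttachPendent.
Variables (G : sgraph) (z : G) (k : nat).

Definition attach_rel (u v : G + 'I_k) : bool :=
  match u, v with
  | inl x, inl y => sedge x y
  | inl x, inr _ => x == z
  | inr _, inl y => y == z
  | inr _, inr _ => false
  end.

Lemma attach_sym : symmetric attach_rel.
Proof. by case=> [x|i] [y|j] //=; apply: sedge_sym. Qed.

Lemma attach_irr : irreflexive attach_rel.
Proof. by case=> [x|i] //=; apply: sedge_irr. Qed.

Definition attach_pendent : sgraph := SGraph attach_sym attach_irr.

End AttachPendent.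

Section CompleteGraph.
Variable n : nat.

Definition complete_rel (i j : 'I_n) : bool := i != j.

Lemma complete_sym : symmetric complete_rel.
Proof. by move=> i j; rewrite /complete_rel eq_sym. Qed.

Lemma complete_irr : irreflexive complete_rel.
Proof. by move=> i; rewrite /complete_rel eqxx. Qed.

Definition complete_graph : sgraph := SGraph complete_sym complete_irr.

End CompleteGraph.

(* z = 0, y = 1 and a_1, a_2, a_3 = 2, 3, 4: the only non-adjacent pairs are
   the pairs of a_i's. *)
Definition book_rel (i j : 'I_5) : bool :=
  (i != j) && ((i < 2) || (j < 2))%N.

Lemma book_sym : symmetric book_rel.
Proof. by move=> i j; rewrite /book_rel eq_sym orbC. Qed.

Lemma book_irr : irreflexive book_rel.
Proof. by move=> i; rewrite /book_rel eqxx. Qed.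

Definition book_graph : sgraph := SGraph book_sym book_irr.

(* n is the number of vertices when 5 <= n, resp. 4 <= n; below that the
   truncated subtraction makes the value meaningless. *)
Definition H6 (n : nat) : sgraph :=
  @attach_pendent book_graph (ord0 : 'I_5) (n - 5).

Definition H7 (n : nat) : sgraph :=
  @attach_pendent (complete_graph 4) (ord0 : 'I_4) (n - 4).

Section SLEE.
Variable R : realType.

(* The vertices are numbered by the canonical enumeration of the finType. *)
Definition adjacency_mx (G : sgraph) : 'M[R]_#|G| :=
  \matrix_(i, j) (sedge (enum_val i) (enum_val j))%:R.

Definition degree_mx (G : sgraph) : 'M[R]_#|G| :=
  diag_mx (\row_i (degree (enum_val i))%:R).

Definition signless_laplacian (G : sgraph) : 'M[R]_#|G| :=
  degree_mx G + adjacency_mx G.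

(* The real eigenvalues, each repeated according to its multiplicity as a root
   of the characteristic polynomial ([rootsR] lists every root once). For a
   symmetric matrix this is the whole spectrum: see [eigenvaluesP]. *)
Definition eigenvalues (n : nat) (M : 'M[R]_n) : seq R :=
  flatten [seq nseq (mup x (char_poly M)) x | x <- rootsR (char_poly M)].

Definition SLEE (G : sgraph) : R :=
  \sum_(q <- eigenvalues (signless_laplacian G)) expR q.

Lemma eigenvaluesP n (M : 'M[R]_n) : M^T = M ->
  char_poly M = \prod_(q <- eigenvalues M) ('X - q%:P).
Proof.
move=> symM; pose c := real_complex R; pose A := map_mx c M.
have hA : A \is hermsymmx.
  apply: realsym_hermsym.
    apply/is_hermitianmxP; rewrite expr0 scale1r; apply/matrixP => i j.
    by rewrite !mxE -[in LHS]symM mxE.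
  by apply/mxOverP => i j; rewrite mxE complex_real.
have /orthomx_spectralP := hermitian_normalmx hA.
have /mxOverP := hermitian_spectral_diag_real hA.
have := spectral_unit A.
move: (spectralmx A) (spectral_diag A) => P d uP dR eA.
have cA : char_poly A = \prod_(i < n) ('X - (d 0 i)%:P).
  transitivity (char_poly (diag_mx d)); last first.
    rewrite char_poly_trig; last exact/diag_mx_is_trig.
    by apply: eq_bigr => i _; rewrite mxE eqxx.
  have uP' : map_mx polyC (invmx P) *m map_mx polyC P = 1%:M.
    by rewrite -map_mxM mulVmx // map_mx1.
  rewrite {1}eA /char_poly /char_poly_mx.
  set D := diag_mx d.
  have -> : 'X%:M - map_mx polyC (invmx P *m D *m P) =
    map_mx polyC (invmx P) *m ('X%:M - map_mx polyC D) *m map_mx polyC P.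
    by rewrite mulmxBr mulmxBl !map_mxM /= scalar_mxC -['X%:M *m _ *m _]mulmxA uP' mulmx1.
  by rewrite !det_mulmx mulrAC -det_mulmx uP' det1 mul1r.
pose s := [seq complex.Re (d 0 i) | i <- enum 'I_n].
have cM : char_poly M = \prod_(q <- s) ('X - q%:P).
  apply: (@map_poly_inj _ _ c); rewrite map_char_poly -/A cA rmorph_prod.
  rewrite big_map big_enum; apply: eq_bigr => i _.
  by rewrite /= rmorphB /= map_polyX map_polyC /= RRe_real.
have p0 : char_poly M != 0 by rewrite monic_neq0 ?char_poly_monic.
rewrite {1}cM; apply: perm_big; rewrite perm_sym.
apply/allP => x _ /=; apply/eqP; rewrite -[RHS]mu_prod_XsubC -cM.
rewrite /eigenvalues count_flatten -map_comp sumnE big_map.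
have [xr|xNr] := boolP (x \in rootsR (char_poly M)).
  rewrite (bigD1_seq x) ?uniq_roots //= count_nseq /= eqxx mul1n.
  by rewrite big1 ?addn0 // => y /negPf yx; rewrite count_nseq /= yx.
rewrite mupNroot; last first.
  by apply: contra xNr; rewrite -(roots_on_rootsR p0) // in_itv.
rewrite big1_seq // => y /= yr; rewrite count_nseq /=.
by case: eqP yr xNr => [->->|].
Qed.

Lemma signless_laplacian_sym (G : sgraph) :
  (signless_laplacian G)^T = signless_laplacian G.
Proof.
rewrite /signless_laplacian linearD /= tr_diag_mx; congr (_ + _).
by apply/matrixP => i j; rewrite !mxE sedge_sym.
Qed.

End SLEE.

(* Main.v *)
From mathcomp Require Import boolp classical_sets functions topology.
From mathcomp Require Import normedtype sequences exp.
From mathcomp Require Import complex.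
From mathcomp Require Import lra zify.
From mathcomp Require Import all_boot all_order all_algebra.
From mathcomp Require Import reals.
Require Import Defs.
Import Order.TTheory GRing.Theory Num.Theory.
Import numFieldNormedType.Exports.
Local Open Scope ring_scope.

Set Implicit Arguments.
Unset Strict Implicit.
Unset Printing Implicit Defensive.

(** Write [Q] for the signless Laplacian.  Expanding the exponential gives
    [SLEE G = \sum_k \tr (Q ^+ k) / k!], so it is enough to compare the
    spectral moments [\tr (Q ^+ k)].

    The comparison uses the Kelmans transformation: given two vertices [u] and
    [v], every edge [v w] such that [w] is not adjacent to [u] is replaced by
    [u w].  Take the basis in which the basis vectors [e_u] and [e_v] are
    replaced by [e_u + e_v] and [e_u - e_v].  In this basis the matrix of the
    transformed graph dominates the absolute value of the matrix of the original
    graph, entry by entry ([ler_norm_paired_kelmans]), so no moment decreases.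
    If both [u] and [v] have a private neighbour, then the sum of the squared
    degrees, and hence the second moment, increases strictly
    ([ltr_SLEE_kelmans]).  The number of edges is preserved, and so is
    connectedness as soon as [u] and [v] are adjacent or have a common
    neighbour.

    Since the sum of the squared degrees is bounded, repeating such strict moves
    ends at a connected graph that admits none.  There a vertex [z] of maximum
    degree dominates the graph, and the remaining vertices carry three edges,
    each of which meets, or joins two neighbours of, a vertex [y] of maximum
    degree among them: they form a star [K_{1,3}] or a triangle, which gives
    [H6 n] or [H7 n] ([stable_tricyclic_giso]).

    Finally [H6 n] and [H7 n] have the same spectrum.  Conjugation by the
    orthogonal matrix [J / 2 - 1] on four non-central vertices maps the vector
    [e_i + e_j] to the vector [e_k + e_l] of the complementary pair, so it turns
    the signless Laplacian of the star on these vertices into that of a triangle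
    plus an isolated vertex; it fixes the all-ones vector, so that it does not
    affect the edges to [z] ([switching_book_kite]). *)

(** * Traces of powers of a matrix *)

Lemma mulmx_conjX (R : pzRingType) n (A B P P' : 'M[R]_n) k :
  P *m P' = 1%:M -> A = P' *m B *m P -> A ^+ k.+1 = P' *m B ^+ k.+1 *m P.
Proof.
move=> PP' eA; elim: k => [|k IHk]; first by rewrite !expr1.
rewrite exprS IHk eA (exprS B k.+1) -!mulmxE !mulmxA.
by rewrite -[P' *m B *m P *m P']mulmxA PP' mulmx1.
Qed.

Lemma mxtrace_conjX (R : comPzRingType) n (A B P P' : 'M[R]_n) k :
  P *m P' = 1%:M -> A = P' *m B *m P -> \tr (A ^+ k) = \tr (B ^+ k).
Proof.
move=> PP' eA; case: k => [|k]; first by rewrite !expr0.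
by rewrite (mulmx_conjX k PP' eA) mxtrace_mulC mulmxA PP' mul1mx.
Qed.

Lemma mxtrace_reindexX (R : pzRingType) m n (A : 'M[R]_m) (B : 'M[R]_n)
    (s : 'I_m -> 'I_n) k :
  bijective s -> (forall i j, A i j = B (s i) (s j)) ->
  \tr (A ^+ k) = \tr (B ^+ k).
Proof.
move=> sB AB; have eX i j : (A ^+ k) i j = (B ^+ k) (s i) (s j).
  elim: k i j => [|k IHk] i j.
    by rewrite !expr0 !mxE (inj_eq (bij_inj sB)).
  rewrite !exprS -!mulmxE !mxE [RHS](reindex s) /=; last exact: onW_bij.
  by apply: eq_bigr => l _; rewrite AB IHk.
rewrite /mxtrace [RHS](reindex s) /=; last exact: onW_bij.
by apply: eq_bigr.
Qed.

Lemma ler_mxtraceX (R : realDomainType) n (A B : 'M[R]_n) k :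
  (forall i j, `|A i j| <= B i j) -> \tr (A ^+ k) <= \tr (B ^+ k).
Proof.
move=> AB; have eX i j : `|(A ^+ k) i j| <= (B ^+ k) i j.
  elim: k i j => [|k IHk] i j.
    by rewrite !expr0 !mxE normr_nat.
  rewrite !exprS -!mulmxE !mxE (le_trans (ler_norm_sum _ _ _)) //.
  by apply: ler_sum => l _; rewrite normrM ler_pM.
by apply: ler_sum => i _; apply: le_trans (ler_norm _) (eX i i).
Qed.

Lemma diag_mxX (R : pzRingType) n (d : 'rV[R]_n) k :
  diag_mx d ^+ k = diag_mx (\row_i d 0 i ^+ k).
Proof.
elim: k => [|k IHk].
  by rewrite expr0; apply/matrixP => i j; rewrite !mxE expr0.
rewrite exprS IHk -mulmxE mulmx_diag; congr diag_mx.
by apply/rowP => i; rewrite !mxE exprS.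
Qed.

Lemma char_poly_conj (R : comNzRingType) n (A B P P' : 'M[R]_n) :
  P' *m P = 1%:M -> A = P' *m B *m P -> char_poly A = char_poly B.
Proof.
move=> P'P eA; rewrite eA /char_poly /char_poly_mx.
have uP' : map_mx polyC P' *m map_mx polyC P = 1%:M by rewrite -map_mxM P'P map_mx1.
have -> : 'X%:M - map_mx polyC (P' *m B *m P) =
    map_mx polyC P' *m ('X%:M - map_mx polyC B) *m map_mx polyC P.
  by rewrite mulmxBr mulmxBl !map_mxM /= scalar_mxC -['X%:M *m _ *m _]mulmxA uP' mulmx1.
by rewrite !det_mulmx mulrAC -det_mulmx uP' det1 mul1r.
Qed.

(** * Spectral moments and the exponential sum *)

Lemma sum_eigenvaluesX (R : realType) n (M : 'M[R]_n) k : M^T = M ->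
  \sum_(q <- eigenvalues M) q ^+ k = \tr (M ^+ k).
Proof.
move=> symM; pose c := real_complex R; pose A := map_mx c M.
have hA : A \is hermsymmx.
  apply: realsym_hermsym.
    apply/is_hermitianmxP; rewrite expr0 scale1r; apply/matrixP => i j.
    by rewrite !mxE -[in LHS]symM mxE.
  by apply/mxOverP => i j; rewrite mxE complex_real.
have /orthomx_spectralP := hermitian_normalmx hA.
have := spectral_unit A.
move: (spectralmx A) (spectral_diag A) => P d uP eA.
have cA : char_poly A = \prod_(i < n) ('X - (d 0 i)%:P).
  rewrite (char_poly_conj (mulVmx uP) eA) char_poly_trig; last exact/diag_mx_is_trig.
  by apply: eq_bigr => i _; rewrite mxE eqxx.
(* the diagonal entries of the complex diagonalisation are the real eigenvalues *)
have dE : perm_eq [seq d 0 i | i <- index_enum _] [seq c q | q <- eigenvalues M].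
  apply: prod_XsubC_eq; rewrite !big_map -cA /A -map_char_poly.
  rewrite (eigenvaluesP symM) rmorph_prod; apply: eq_bigr => q _.
  by rewrite rmorphB /= map_polyX map_polyC.
apply: (@fmorph_inj _ _ c); rewrite -trace_map_mx rmorphXn.
rewrite (mxtrace_conjX k (mulmxV uP) eA) diag_mxX mxtrace_diag rmorph_sum /=.
under [RHS]eq_bigr do rewrite mxE.
under [LHS]eq_bigr do rewrite rmorphXn.
rewrite -(big_map c predT (fun x => x ^+ k)) -(perm_big _ dE) /=.
by rewrite big_map.
Qed.

(** [SLEE G] is the sum of the series of the moments [\tr (Q ^+ k) / k!]. *)
Lemma SLEE_cvg (R : realType) (G : sgraph) :
  ((\sum_(0 <= k < j) \tr (signless_laplacian R G ^+ k) / k`!%:R)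
     @[j --> \oo] --> SLEE R G)%classic.
Proof.
have -> : (fun j => \sum_(0 <= k < j) \tr (signless_laplacian R G ^+ k) / k`!%:R)
  = (fun j => \sum_(q <- eigenvalues (signless_laplacian R G))
                series (exp_coeff q) j).
  apply/funext => j; rewrite exchange_big /=; apply: eq_bigr => k _.
  by rewrite -sum_eigenvaluesX ?signless_laplacian_sym // mulr_suml.
apply: (@cvg_big _ _ _ _ xpredT) => [|q _]; first exact: add_continuous.
exact: is_cvg_series_exp_coeff.
Qed.

Lemma eq_SLEE (R : realType) (G H : sgraph) :
  (forall k, \tr (signless_laplacian R G ^+ k) = \tr (signless_laplacian R H ^+ k)) ->
  SLEE R G = SLEE R H.
Proof.
move=> GH; apply: (cvg_unique _ (@SLEE_cvg R G)) => //=.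
by under eq_cvg do under eq_bigr do rewrite GH; exact: SLEE_cvg.
Qed.

(** One strict inequality between moments suffices: the partial sums that
    include the index [j] differ by at least the difference of the [j]-th
    terms. *)
Lemma ltr_SLEE (R : realType) (G H : sgraph) (j : nat) :
  (forall k, \tr (signless_laplacian R G ^+ k) <= \tr (signless_laplacian R H ^+ k)) ->
  \tr (signless_laplacian R G ^+ j) < \tr (signless_laplacian R H ^+ j) ->
  SLEE R G < SLEE R H.
Proof.
move=> GH GHj.
pose e := (\tr (signless_laplacian R H ^+ j)
           - \tr (signless_laplacian R G ^+ j)) / j`!%:R.
have e0 : 0 < e by rewrite divr_gt0 ?subr_gt0 // ltr0n fact_gt0.
rewrite -subr_gt0; apply: (lt_le_trans e0).
have dC := cvgB (@SLEE_cvg R H) (@SLEE_cvg R G).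
apply: (cvgr_to_ge (dC _)); near=> N.
have jN : (j < N)%N by near: N; exact: nbhs_infty_gt.
rewrite !fctE -sumrB (bigD1_seq j) ?mem_index_iota ?iota_uniq //= -mulrBl lerDl.
apply: sumr_ge0 => k _; rewrite -mulrBl divr_ge0 ?subr_ge0 //.
Unshelve. all: by end_near. Qed.

(** * Matrices indexed by a finite type *)

Section FunMx.
Variables (R : pzRingType) (T : finType).
Implicit Types f g : T -> T -> R.

(** The matrix with entries [f x y], the elements of [T] being numbered by their
    canonical enumeration. *)
Definition fun_mx f : 'M[R]_#|T| := \matrix_(i, j) f (enum_val i) (enum_val j).

Lemma eq_fun_mx f g : (forall x y, f x y = g x y) -> fun_mx f = fun_mx g.
Proof. by move=> fg; apply/matrixP => i j; rewrite !mxE. Qed.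

Lemma mul_fun_mx f g :
  fun_mx f *m fun_mx g = fun_mx (fun x y => \sum_z f x z * g z y).
Proof.
apply/matrixP => i j; rewrite !mxE [RHS](reindex (@enum_val T T)) /=.
  by apply: eq_bigr => k _; rewrite !mxE.
exact/onW_bij/enum_val_bij.
Qed.

Lemma fun_mx1 : fun_mx (fun x y => (x == y)%:R) = 1%:M.
Proof.
by apply/matrixP => i j; rewrite !mxE (inj_eq enum_val_inj).
Qed.

Lemma mxtrace_fun_mx f : \tr (fun_mx f) = \sum_x f x x.
Proof.
rewrite [RHS](reindex (@enum_val T T)) /=; last exact/onW_bij/enum_val_bij.
by apply: eq_bigr => i _; rewrite mxE.
Qed.

End FunMx.

(** * The signless Laplacian and the degrees *)

Section SignlessLaplacian.
Variables (R : realType).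

(** The entry of the signless Laplacian at a pair of vertices. *)
Definition sl_entry (G : sgraph) (x y : G) : R :=
  (degree x)%:R *+ (x == y) + (sedge x y)%:R.

Lemma signless_laplacianE (G : sgraph) :
  signless_laplacian R G = fun_mx (@sl_entry G).
Proof.
by apply/matrixP => i j; rewrite !mxE /sl_entry (inj_eq enum_val_inj).
Qed.

Lemma degreeE (G : sgraph) (x : G) : degree x = (\sum_y sedge x y)%N.
Proof. by rewrite /degree cardsE -sum1_card big_mkcond. Qed.

Lemma degree_giso (G H : sgraph) (f : G -> H) (x : G) : bijective f ->
  (forall x y, sedge (f x) (f y) = sedge x y) -> degree (f x) = degree x.
Proof.
move=> fB fE; rewrite !degreeE (reindex f) /=; last exact: onW_bij.
by apply: eq_bigr => y _; rewrite fE.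
Qed.

Lemma SLEE_giso (G H : sgraph) : giso G H -> SLEE R G = SLEE R H.
Proof.
move=> [f [fB fE]]; apply: eq_SLEE => k; rewrite !signless_laplacianE.
apply: (@mxtrace_reindexX _ _ _ _ _ (fun i => enum_rank (f (enum_val i)))).
  exact: bij_comp (@enum_rank_bij _) (bij_comp fB (@enum_val_bij _)).
move=> i j; rewrite !mxE !enum_rankK /sl_entry fE (inj_eq (bij_inj fB)).
by rewrite (degree_giso _ fB).
Qed.

Lemma mxtrace_sl2 (G : sgraph) :
  \tr (signless_laplacian R G ^+ 2) =
  (\sum_(x : G) degree x ^ 2 + \sum_(x : G) degree x)%N%:R.
Proof.
rewrite expr2 -mulmxE signless_laplacianE mul_fun_mx mxtrace_fun_mx.
rewrite -big_split natr_sum /=; apply: eq_bigr => x _.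
rewrite (bigD1 x) //= /sl_entry eqxx sedge_irr mulr1n addr0 -natrM natrD mulnn.
congr (_ + _); rewrite [in RHS]degreeE [in RHS](bigD1 x) //= sedge_irr add0n.
rewrite natr_sum.
apply: eq_bigr => y yx; rewrite eq_sym (negPf yx) !mulr0n !add0r sedge_sym.
by rewrite -natrM mulnb andbb.
Qed.

End SignlessLaplacian.

Lemma handshake (G : sgraph) :
  (\sum_(x : G) degree x = 2 * #|edges G|)%N.
Proof.
under eq_bigr do rewrite degreeE.
rewrite pair_bigA /=.
rewrite (eq_bigr (fun p : G * G => if sedge p.1 p.2 then 1%N else 0%N)); last first.
  by move=> p _; case: sedge.
rewrite -big_mkcond /=.
rewrite (partition_big (fun p : G * G => [set p.1; p.2]) (mem (edges G))) /=; last first.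
  by move=> p pE; apply/imsetP; exists p; rewrite ?inE.
rewrite mulnC -sum_nat_const; apply: eq_bigr => e /imsetP [[a b]].
rewrite inE /= => ab ->.
(* an edge has exactly two orientations *)
have ab' : a != b by apply: contraTneq ab => ->; rewrite sedge_irr.
transitivity #|[set (a, b); (b, a)]|; last first.
  by rewrite cards2 xpair_eqE (negPf ab').
rewrite -sum1_card; apply: eq_bigl => -[c d]; rewrite !inE /= !xpair_eqE.
apply/andP/orP => [[cd /eqP e1]|[] /andP [/eqP-> /eqP->]]; last 2 first.
- by [].
- by rewrite sedge_sym setUC.
have cd' : c != d by apply: contraTneq cd => ->; rewrite sedge_irr.
have : c \in [set a; b] by rewrite -e1 set21.
have : d \in [set a; b] by rewrite -e1 set22.
by rewrite !inE; case/orP => /eqP ed; case/orP => /eqP ec; subst;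
  rewrite ?eqxx ?orbT; rewrite ?eqxx // in cd'; auto.
Qed.

(** * The Kelmans transformation *)

Section Kelmans.
Variables (G : sgraph) (u v : G).
Hypothesis uv : u != v.

(** Adjacency after the transformation from [v] to [u]: the neighbours of [u]
    become those of [u] or of [v], and the neighbours of [v] those of both; the
    pair [u], [v] and the pairs that avoid [u] and [v] are left unchanged. *)
Definition kelmans_rel (x y : G) : bool :=
  if x == u then
    if y == v then sedge u v else (y != u) && (sedge u y || sedge v y)
  else if x == v then
    if y == u then sedge u v else sedge u y && sedge v y
  else if y == u then sedge u x || sedge v x
  else if y == v then sedge u x && sedge v x
  else sedge x y.

Lemma kelmans_sym : symmetric kelmans_rel.
Proof using uv.
have vu : (v == u) = false by rewrite eq_sym (negPf uv).
move=> x y; rewrite /kelmans_rel.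
case: (eqVneq x u) => [->|xu]; case: (eqVneq y u) => [yu|yu] //=.
  by rewrite yu (negPf uv).
case: (eqVneq x v) => [xv|xv]; case: (eqVneq y v) => [yv|yv] //=.
  by rewrite xv yv.
exact: sedge_sym.
Qed.

Lemma kelmans_irr : irreflexive kelmans_rel.
Proof.
move=> x; rewrite /kelmans_rel.
have [->|xu] := eqVneq x u; first by case: eqP => // <-; rewrite sedge_irr.
have [->|xv] := eqVneq x v; first by rewrite sedge_irr andbF.
by rewrite sedge_irr.
Qed.

Definition kelmans : sgraph := SGraph kelmans_sym kelmans_irr.

Lemma sum_split2 (f : G -> nat) :
  (\sum_y f y = f u + f v + \sum_(y | (y != u) && (y != v)) f y)%N.
Proof using uv. by rewrite (bigD1 u) //= (bigD1 v) ?(eq_sym v) //= addnA. Qed.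

Lemma kelmans_degree_other (x : G) : x != u -> x != v ->
  degree (x : kelmans) = degree x.
Proof using uv.
move=> xu xv; rewrite !degreeE /= [LHS]sum_split2 [RHS]sum_split2.
have vu : (v == u) = false by rewrite eq_sym (negPf uv).
congr (_ + _)%N; rewrite /kelmans_rel ?(negPf xu) ?(negPf xv) ?eqxx ?vu.
  by rewrite !(sedge_sym x); case: sedge; case: sedge.
by apply: eq_bigr => y /andP [/negPf-> /negPf->].
Qed.

(** The number of neighbours of [a] that are neither adjacent to [b] nor equal to
    [u] or [v]; it is used for [a] and [b] equal to [u] and [v], in either
    order. *)
Definition excess (a b : G) : nat :=
  (\sum_(y | (y != u) && (y != v)) (sedge a y && ~~ sedge b y))%N.

Lemma excess_gt0 (a b w : G) :
  sedge a w -> ~~ sedge b w -> w != u -> w != v -> (0 < excess a b)%N.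
Proof.
by move=> aw bw wu wv; rewrite /excess (bigD1 w) ?wu ?wv //= aw bw.
Qed.

Lemma kelmans_degrees :
  [/\ degree (u : kelmans) = (degree u + excess v u)%N,
      degree (u : kelmans) = (degree v + excess u v)%N,
      degree u = (degree (v : kelmans) + excess u v)%N,
      sedge u v <= degree u & sedge u v <= degree v]%N.
Proof using uv.
have vu : (v == u) = false by rewrite eq_sym (negPf uv).
pose rest (f : G -> bool) := (\sum_(y | (y != u) && (y != v)) f y)%N.
have eK (x : G) : degree (x : kelmans) =
    (kelmans_rel x u + kelmans_rel x v + rest (kelmans_rel x))%N.
  by rewrite degreeE; exact: sum_split2.
have eG (x : G) : degree x = (sedge x u + sedge x v + rest (sedge x))%N.
  by rewrite degreeE; exact: sum_split2.
have e1 : rest (kelmans_rel u) = (rest (sedge u) + excess v u)%N.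
  rewrite /rest /excess -big_split; apply: eq_bigr => y /andP [/negPf yu /negPf yv] /=.
  by rewrite /kelmans_rel eqxx yu yv /=; case: sedge; case: sedge.
have e2 : rest (kelmans_rel u) = (rest (sedge v) + excess u v)%N.
  rewrite /rest /excess -big_split; apply: eq_bigr => y /andP [/negPf yu /negPf yv] /=.
  by rewrite /kelmans_rel eqxx yu yv /=; case: sedge; case: sedge.
have e3 : rest (sedge u) = (rest (kelmans_rel v) + excess u v)%N.
  rewrite /rest /excess -big_split; apply: eq_bigr => y /andP [/negPf yu _] /=.
  by rewrite /kelmans_rel eqxx vu yu /=; case: sedge; case: sedge.
have [kuu kvv] : kelmans_rel u u = false /\ kelmans_rel v v = false.
  by rewrite !kelmans_irr.
have [kuv kvu] : kelmans_rel u v = sedge u v /\ kelmans_rel v u = sedge u v.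
  by rewrite /kelmans_rel !eqxx vu.
rewrite !eK !eG !sedge_irr kuu kvv kuv kvu (sedge_sym v u).
by split; lia.
Qed.

End Kelmans.

Section KelmansSums.
Variables (G : sgraph) (u v : G).
Hypothesis uv : u != v.
Local Notation G' := (kelmans uv).

Lemma kelmans_sum_degree : (\sum_(x : G') degree x = \sum_(x : G) degree x)%N.
Proof using uv.
rewrite [LHS](sum_split2 uv) [RHS](sum_split2 uv).
congr (_ + _)%N; first by have [? ? ? _ _] := kelmans_degrees uv; lia.
by apply: eq_bigr => x /andP [xu xv]; rewrite kelmans_degree_other.
Qed.

Lemma kelmans_card_edges : #|edges G'| = #|edges G|.
Proof using uv.
by have := kelmans_sum_degree; rewrite !handshake => /eqP; rewrite eqn_mul2l => /eqP.
Qed.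

Lemma kelmans_sum_degree2 (w1 w2 : G) :
  sedge u w1 -> ~~ sedge v w1 -> w1 != v ->
  sedge v w2 -> ~~ sedge u w2 -> w2 != u ->
  (\sum_(x : G) degree x ^ 2 < \sum_(x : G') degree x ^ 2)%N.
Proof using uv.
move=> uw1 vw1 w1v vw2 uw2 w2u.
have w1u : w1 != u by apply: contraTneq uw1 => ->; rewrite sedge_irr.
have w2v : w2 != v by apply: contraTneq vw2 => ->; rewrite sedge_irr.
rewrite [ltnLHS](sum_split2 uv) [ltnRHS](sum_split2 uv).
rewrite [X in (_ < _ + X)%N](eq_bigr (fun x : G => degree x ^ 2)%N); last first.
  by move=> x /andP [xu xv]; rewrite kelmans_degree_other.
rewrite ltn_add2r; have [] := kelmans_degrees uv.
have := excess_gt0 vw2 uw2 w2u w2v; have := excess_gt0 uw1 vw1 w1u w1v.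
by nia.
Qed.

Lemma kelmans_connected :
  sedge u v || [exists c, sedge u c && sedge v c] -> connected G -> connected G'.
Proof using uv.
move=> huv [G0 conG]; split=> // x y; apply: connect_sub (conG x y).
have vu : (v == u) = false by rewrite eq_sym (negPf uv).
have cs := sym_connect_sym (@sedge_sym G').
have cuv : connect (@sedge G') u v.
  case/orP: huv => [uv1|/existsP [c /andP [uc vc]]].
    by apply: connect1; rewrite /= /kelmans_rel !eqxx.
  have cu : c != u by apply: contraTneq uc => ->; rewrite sedge_irr.
  have cv : c != v by apply: contraTneq vc => ->; rewrite sedge_irr.
  apply: (@connect_trans _ _ c); apply: connect1.
    by rewrite /= /kelmans_rel eqxx (negPf cu) (negPf cv) uc.
  by rewrite /= /kelmans_rel (negPf cu) (negPf cv) vu eqxx uc vc.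
(* an edge at v is replaced by the path through u *)
have cu w : sedge u w || sedge v w -> connect (@sedge G') u w.
  have [->|wv] := eqVneq w v; first by [].
  have [->|wu] := eqVneq w u; first by rewrite connect0.
  by move=> h; apply: connect1; rewrite /= /kelmans_rel eqxx (negPf wv) wu.
have cv w : sedge v w -> connect (@sedge G') v w.
  move=> vw; apply: connect_trans (cu w _); last by rewrite vw orbT.
  by rewrite cs.
move=> a b ab.
have [eau|au] := eqVneq a u; first by rewrite eau in ab *; rewrite cu ?ab.
have [eav|av] := eqVneq a v; first by rewrite eav in ab *; rewrite cv.
have [ebu|bu] := eqVneq b u; first by rewrite ebu sedge_sym in ab *; rewrite cs cu ?ab.
have [ebv|bv] := eqVneq b v; first by rewrite ebv sedge_sym in ab *; rewrite cs cv.
by apply: connect1; rewrite /= /kelmans_rel (negPf au) (negPf av) (negPf bu) (negPf bv).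
Qed.

End KelmansSums.

(** * Comparing the moments before and after the transformation *)

Lemma sum_delta (R : pzSemiRingType) (T : finType) (f : T -> R) (x : T) :
  \sum_z (x == z)%:R * f z = f x.
Proof.
rewrite (bigD1 x) //= eqxx mul1r big1 ?addr0 // => z /negPf zx.
by rewrite eq_sym zx mul0r.
Qed.

Section KelmansTrace.
Variables (R : realType) (G : sgraph) (u v : G).
Hypothesis uv : u != v.
Local Notation G' := (kelmans uv).

(** The three possible positions of a vertex with respect to [u] and [v]. *)
Variant locate_spec (x : G) : bool -> bool -> bool -> bool -> Type :=
  | LocateU of x = u : locate_spec x true false true false
  | LocateV of x = v : locate_spec x false true false true
  | LocateOther of x != u & x != v : locate_spec x false false false false.

Lemma locateP (x : G) : locate_spec x (x == u) (x == v) (u == x) (v == x).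
Proof using uv.
rewrite !(eq_sym _ x); have [xu|xu] := eqVneq x u.
  by rewrite xu (negPf uv); exact: LocateU.
by have [xv|xv] := eqVneq x v; [exact: LocateV|exact: LocateOther].
Qed.

(** The values of the linear form [f] on the basis obtained by replacing [e_u]
    and [e_v] by [e_u + e_v] and [e_u - e_v]. *)
Definition pairing (f : G -> R) (x : G) : R :=
  if x == u then f u + f v else if x == v then f u - f v else f x.

(** The matrix of this change of basis.  It is symmetric, and its square is the
    inverse of the diagonal matrix with entries [scaling]. *)
Definition base_change (x y : G) : R := pairing (fun z => (z == y)%:R) x.

Definition scaling (x : G) : R := if (x == u) || (x == v) then 2^-1 else 1.

Lemma sum_base_changel (f : G -> R) (x : G) :
  \sum_z base_change x z * f z = pairing f x.
Proof.
rewrite /base_change /pairing; case: eqP => _; [|case: eqP => _]; rewrite -?(sum_delta f).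
- by rewrite -big_split; apply: eq_bigr => z _; rewrite mulrDl.
- by rewrite -sumrB; apply: eq_bigr => z _; rewrite mulrBl.
by [].
Qed.

Lemma base_changeC (x y : G) : base_change x y = base_change y x.
Proof using uv.
have vu : (v == u) = false by rewrite eq_sym (negPf uv).
rewrite /base_change /pairing; case: (locateP x) => [xu|xv|xu xv];
  case: (locateP y) => [yu|yv|yu yv];
  rewrite ?xu ?xv ?yu ?yv ?eqxx ?vu ?(negPf uv)
    ?(addr0, add0r, subr0, oppr0) ?(negPf xu) ?(negPf xv) ?(negPf yu) ?(negPf yv) //=.
by rewrite eq_sym.
Qed.

Lemma base_changeK :
  fun_mx base_change *m fun_mx (fun x y => base_change x y * scaling y) = 1%:M.
Proof using uv.
have vu : (v == u) = false by rewrite eq_sym (negPf uv).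
rewrite mul_fun_mx -fun_mx1; apply: eq_fun_mx => x y.
rewrite sum_base_changel /base_change /pairing /scaling ?eqxx ?vu ?(negPf uv).
case: (locateP x) => [xu|xv|xu xv]; case: (locateP y) => [yu|yv|yu yv] //=;
  rewrite ?xu ?xv ?yu ?yv ?eqxx ?vu ?(negPf uv) ?(negPf xu) ?(negPf yu)
    ?(negPf xv) ?(negPf yv) ?(eq_sym u) ?(eq_sym v) ?(negPf yu) ?(negPf yv) ?mulr1 //=; lra.
Qed.

(** The entries of [P *m F *m P^-1], where [F] is the matrix of [f] and [P] the
    change of basis.  Up to the positive factor [scaling y] they are the values
    of the bilinear form [f] on pairs of vectors of the new basis. *)
Definition paired (f : G -> G -> R) (x y : G) : R :=
  pairing (fun z => pairing (f^~ z) x) y * scaling y.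

Lemma fun_mx_paired (f : G -> G -> R) :
  fun_mx (paired f) =
  fun_mx base_change *m fun_mx f *m fun_mx (fun x y => base_change x y * scaling y).
Proof using uv.
rewrite !mul_fun_mx; apply: eq_fun_mx => x y.
rewrite /paired -sum_base_changel mulr_suml; apply: eq_bigr => z _.
by rewrite sum_base_changel base_changeC mulrCA mulrA.
Qed.

Lemma mxtrace_paired (f : G -> G -> R) k :
  \tr (fun_mx (paired f) ^+ k) = \tr (fun_mx f ^+ k).
Proof using uv.
exact: (mxtrace_conjX k (mulmx1C base_changeK) (fun_mx_paired f)).
Qed.

(** On the new basis the two forms agree up to sign, except at the pair
    [e_u + e_v], [e_u - e_v], where the value passes from the difference to the
    sum of the two excesses.  The entry at [e_u - e_v] is nonnegative because
    [degree u + degree v] is at least 2 when [u] and [v] are adjacent. *)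
Lemma ler_norm_paired_kelmans (x y : G) :
  `|paired (@sl_entry R G) x y| <= paired (@sl_entry R G') x y.
Proof using uv.
have vu : (v == u) = false by rewrite eq_sym (negPf uv).
have s0 : 0 <= scaling y by rewrite /scaling; case: ifP => _; lra.
rewrite /paired normrM (ger0_norm s0) ler_wpM2r // /pairing.
have [] := kelmans_degrees uv.
(* all degrees are expressed by that of v in the new graph and the excesses *)
move: (excess u v u v) (excess u v v u) => n1 n2 eu' eu'' eu le_u le_v.
have ev : degree v = (degree (v : G') + n2)%N by lia.
have bu : (sedge u v)%:R <= (degree u)%:R :> R by rewrite ler_nat.
have bv : (sedge u v)%:R <= (degree v)%:R :> R by rewrite ler_nat.
move: bu bv; rewrite /sl_entry eu' eu ev !natrD.
have := ler0n R n1; have := ler0n R n2.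
move: (n1%:R : R) (n2%:R : R) ((@degree G' v)%:R : R) => r1 r2 d r1_ge0 r2_ge0 bu bv.
case: (locateP x) => [xE|xE|xu xv]; case: (locateP y) => [yE|yE|yu yv];
  rewrite /sl_entry /= /kelmans_rel ?xE ?yE ?eqxx ?vu ?(negPf uv)
    ?(negPf xu) ?(negPf xv) ?(negPf yu) ?(negPf yv)
    ?(eq_sym u) ?(eq_sym v) ?vu
    ?(negPf xu) ?(negPf xv) ?(negPf yu) ?(negPf yv) /=
     ?(sedge_sym v u) ?(sedge_irr u) ?(sedge_irr v) ?andbF ?mulr1n ?mulr0n
   ?(sedge_sym x u) ?(sedge_sym x v) ?(kelmans_degree_other uv xu xv).
all: try by rewrite ler_norml; have ? := ler0n R (sedge u v); apply/andP; split; lra.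
all: try by case: sedge; case: sedge; rewrite ler_norml /=; apply/andP; split; lra.
by rewrite ger0_norm // addr_ge0 // mulrn_wge0.
Qed.

Lemma ler_mxtrace_kelmans k :
  \tr (signless_laplacian R G ^+ k) <= \tr (signless_laplacian R G' ^+ k).
Proof using uv.
rewrite !signless_laplacianE -[leLHS]mxtrace_paired.
have -> : \tr (fun_mx (sl_entry R (G:=G')) ^+ k) =
          \tr (fun_mx (paired (@sl_entry R G')) ^+ k).
  exact/esym/mxtrace_paired.
by apply: ler_mxtraceX => i j; rewrite !mxE ler_norm_paired_kelmans.
Qed.

Lemma ltr_SLEE_kelmans (w1 w2 : G) :
  sedge u w1 -> ~~ sedge v w1 -> w1 != v ->
  sedge v w2 -> ~~ sedge u w2 -> w2 != u -> SLEE R G < SLEE R G'.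
Proof using uv.
move=> uw1 vw1 w1v vw2 uw2 w2u.
apply: (@ltr_SLEE _ _ _ 2); first exact: ler_mxtrace_kelmans.
rewrite !mxtrace_sl2 ltr_nat kelmans_sum_degree ltn_add2r.
exact: kelmans_sum_degree2 uw1 vw1 w1v vw2 uw2 w2u.
Qed.

End KelmansTrace.

(** * Connected graphs without strict Kelmans moves *)

Section Stable.
Variable G : sgraph.

(** Adjacent, or with a common neighbour. *)
Definition dist_le2 (u v : G) := sedge u v || [exists c, sedge u c && sedge v c].

(** [w1] and [w2] are private neighbours of [u] and of [v], so that the Kelmans
    transformation is strict, and [u], [v] are close enough for it to preserve
    connectedness. *)
Definition kelmans_movable (u v w1 w2 : G) :=
  [&& u != v, dist_le2 u v, sedge u w1, ~~ sedge v w1, w1 != v,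
      sedge v w2, ~~ sedge u w2 & w2 != u].

(** No strict Kelmans move is possible. *)
Definition stable := forall u v w1 w2, ~~ kelmans_movable u v w1 w2.

(** In a stable graph the neighbourhoods of two close vertices are nested, so a
    vertex with a private neighbour has the larger degree. *)
Lemma stable_ltn_degree (u v w : G) : stable -> u != v -> dist_le2 u v ->
  sedge v w -> ~~ sedge u w -> w != u -> (degree u < degree v)%N.
Proof.
move=> stG uv nuv vw uw wu; have [e1 e2 _ _ _] := kelmans_degrees uv.
have wv : w != v by apply: contraTneq vw => ->; rewrite sedge_irr.
have := excess_gt0 vw uw wu wv; suff : excess u v u v = 0%N by lia.
apply: big1 => x /andP [xu xv]; apply/eqP; rewrite eqb0; apply/negP => /andP [ux vx].
by have := stG u v x w; rewrite /kelmans_movable uv nuv ux vx xv vw uw wu.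
Qed.

Lemma stable_max_dominates (z : G) : stable -> connected G ->
  (forall x : G, degree x <= degree z)%N -> forall x, x != z -> sedge z x.
Proof.
move=> stG [_ conG] zmax x xz.
(* the closed neighbourhood of z is a union of connected components *)
have cl : closed (@sedge G) [pred y | (y == z) || sedge z y].
  apply: intro_closed => [|a b ab]; first exact/sym_connect_sym/sedge_sym.
  rewrite !inE => /orP [/eqP az|za]; first by rewrite -az ab orbT.
  have [->|bz] //= := eqVneq b z; apply: contraT => zb.
  have az : z != a by apply: contraTneq za => ->; rewrite sedge_irr.
  have := stable_ltn_degree stG az _ ab zb bz.
  by rewrite /dist_le2 za ltnNge zmax => /(_ isT).
have := closed_connect cl (conG z x).
by rewrite !inE eqxx (negPf xz).
Qed.

End Stable.

(** * Recognising the extremal graphs *)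

(** A graph that contains an induced copy [h] of [C], all of whose other vertices
    are pendent at [h z], is [C] with pendent vertices attached to [z]. *)
Lemma giso_attach_pendent (C G : sgraph) (z : C) (k : nat) (h : C -> G) :
  injective h -> (forall a b, sedge (h a) (h b) = sedge a b) ->
  (forall x y, x \notin codom h -> sedge x y = (y == h z)) ->
  #|G| = (#|C| + k)%N -> giso G (attach_pendent z k).
Proof.
move=> hI hE hpend cardG.
pose rest := [pred x | x \notin codom h].
have cR : k = #|rest|.
  have := cardC (mem (codom h)); rewrite card_codom // cardG => /addnI <-.
  by apply: eq_card => x; rewrite !inE.
pose g (p : attach_pendent z k) : G :=
  match p with inl a => h a | inr i => enum_val (cast_ord cR i) end.
(* the inverse of g is the isomorphism *)
have gr i : g (inr i) \notin codom h by exact: enum_valP (cast_ord cR i).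
have gI : injective g.
  move=> [a|i] [b|j] //.
  - by move/hI ->.
  - by move=> e; have := gr j; rewrite -e /= codom_f.
  - by move=> e; have := gr i; rewrite e /= codom_f.
  by move/enum_val_inj/cast_ord_inj ->.
have gB : bijective g by apply: inj_card_bij => //; rewrite card_sum card_ord cardG.
have gE p q : sedge (g p) (g q) = sedge p q.
  case: p q => [a|i] [b|j] /=.
  - exact: hE.
  - by rewrite sedge_sym (hpend _ _ (gr j)) (inj_eq hI).
  - by rewrite (hpend _ _ (gr i)) (inj_eq hI).
  rewrite (hpend _ _ (gr i)); apply: contraNF (gr j) => /eqP e.
  by rewrite /= e codom_f.
case: gB => f fg gf; exists f; split; first by exists g.
by move=> x y; rewrite -gE !gf.
Qed.

(** The same criterion when [C] lives on ['I_m.+1], its copy is listed as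
    [z :: t], and [z] dominates the graph. *)
Lemma giso_cone (m : nat) (e : rel 'I_m.+1) (eS : symmetric e)
    (eI : irreflexive e) (G : sgraph) (z : G) (t : seq G) :
  uniq (z :: t) -> size t = m -> (m < #|G|)%N ->
  (forall x, x != z -> sedge z x) ->
  (forall x w, x \notin z :: t -> w != z -> sedge x w = false) ->
  (forall i j : 'I_m.+1, (i < j)%N ->
     sedge (nth z (z :: t) i) (nth z (z :: t) j) = e i j) ->
  giso G (@attach_pendent (SGraph eS eI) (ord0 : 'I_m.+1) (#|G| - m.+1)).
Proof.
move=> us szt mG zE tE eE.
have sz (i : 'I_m.+1) : (i < size (z :: t))%N by rewrite /= szt.
apply: (@giso_attach_pendent (SGraph eS eI) _ _ _ (fun i : 'I_m.+1 => nth z (z :: t) i)).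
- by move=> i j /eqP; rewrite nth_uniq // => /eqP /val_inj.
- move=> i j /=; case: (ltngtP i j) => [||/val_inj ->].
  + exact: eE.
  + by move=> ji; rewrite sedge_sym eS; exact: eE.
  by rewrite sedge_irr eI.
- move=> x w xs; have {}xs : x \notin z :: t.
    apply: contra xs => xs; apply/codomP.
    have xi : (index x (z :: t) < m.+1)%N.
      by rewrite -szt -[X in (_ < X)%N]/(size (z :: t)) index_mem.
    by exists (Ordinal xi); rewrite nth_index.
  have [->|wz] := eqVneq w z; last by rewrite tE // (negPf wz).
  by rewrite sedge_sym zE ?eqxx //; case/norP: xs.
by rewrite card_ord subnKC.
Qed.

Lemma giso_H6 (G : sgraph) (z y a1 a2 a3 : G) :
  uniq [:: z; y; a1; a2; a3] -> (5 <= #|G|)%N ->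
  (forall x, x != z -> sedge z x) ->
  (forall x w, x \notin [:: z; y; a1; a2; a3] -> w != z -> sedge x w = false) ->
  [/\ sedge y a1, sedge y a2 & sedge y a3] ->
  [/\ ~~ sedge a1 a2, ~~ sedge a1 a3 & ~~ sedge a2 a3] ->
  giso G (H6 #|G|).
Proof.
move=> us G5 zE tE [y1 y2 y3] [/negPf n12 /negPf n13 /negPf n23].
have zs x : x \in [:: y; a1; a2; a3] -> sedge z x.
  by move=> xs; apply: zE; apply: contraTneq xs => ->; case/andP: us.
apply: (giso_cone _ _ us) => //.
move=> [[|[|[|[|[|//]]]]] ?] [[|[|[|[|[|//]]]]] ?] //= _.
all: by rewrite ?(y1, y2, y3, n12, n13, n23) //; apply: zs; rewrite !inE eqxx ?orbT.
Qed.

Lemma giso_H7 (G : sgraph) (z y a1 a2 : G) :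
  uniq [:: z; y; a1; a2] -> (4 <= #|G|)%N ->
  (forall x, x != z -> sedge z x) ->
  (forall x w, x \notin [:: z; y; a1; a2] -> w != z -> sedge x w = false) ->
  [/\ sedge y a1, sedge y a2 & sedge a1 a2] ->
  giso G (H7 #|G|).
Proof.
move=> us G4 zE tE [y1 y2 a12].
have zs x : x \in [:: y; a1; a2] -> sedge z x.
  by move=> xs; apply: zE; apply: contraTneq xs => ->; case/andP: us.
apply: (giso_cone _ _ us) => //.
move=> [[|[|[|[|//]]]] ?] [[|[|[|[|//]]]] ?] //= _.
all: by rewrite ?(y1, y2, a12) //; apply: zs; rewrite !inE eqxx ?orbT.
Qed.

(** Let [z] be a dominating vertex and [y] a vertex of maximum degree among the
    others.  If [y] has [k] neighbours besides [z], and [tau] counts the ordered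
    adjacent pairs of remaining vertices, then all these pairs lie among the
    neighbours of [y], and the number of edges gives [2 * k + tau = 6].  So
    either [tau = 0] and [k = 3], or [tau > 0] and [k = 2]. *)
Lemma stable_tricyclic_giso (G : sgraph) : (5 <= #|G|)%N ->
  tricyclic G -> stable G -> giso G (H6 #|G|) \/ giso G (H7 #|G|).
Proof.
move=> G5 [conG eG] stG.
have [z0 _] : exists x : G, x \in G by apply/card_gt0P; exact: leq_trans G5.
pose z := [arg max_(x > z0) degree x]%N.
have zmax (x : G) : (degree x <= degree z)%N.
  rewrite /z; case: arg_maxnP => // i _ h; exact: h.
have zE := stable_max_dominates stG conG zmax.
have zEC x : x != z -> sedge x z by rewrite sedge_sym; exact: zE.
have [y0 y0z] : exists x, x != z.
  have /card_gt0P [x xz] : (0 < #|predC1 z|)%N.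
    by rewrite cardC1 -ltnS prednK // (leq_trans _ G5).
  by exists x.
pose y := [arg max_(x > y0 | x != z) degree x]%N.
have [yz ymax] : y != z /\ forall x : G, x != z -> (degree x <= degree y)%N.
  by rewrite /y; case: arg_maxnP.
clearbody y z => {z0 y0 y0z}.
have zy : z != y by rewrite eq_sym.
(* otherwise x would be a private neighbour of w with respect to y, although
   w does not have a larger degree than y *)
have yE x w : x != z -> w != z -> x != y -> sedge x w -> sedge y x.
  move=> xz wz xy xw; have [<-|wy] := eqVneq w y; first by rewrite sedge_sym.
  apply: contraT => yx; have := ymax _ wz; rewrite leqNgt => /negP[].
  apply: (stable_ltn_degree stG) yx xy; rewrite 1?eq_sym // 1?sedge_sym //.
  by apply/orP; right; apply/existsP; exists z; rewrite !zEC.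
pose rest := [pred x | (x != z) && (x != y)].
pose k := (\sum_(x in rest) sedge y x)%N.
pose tau := (\sum_(x in rest) \sum_(w in rest) sedge x w)%N.
have count : (2 * k + tau = 6)%N.
  have : (\sum_(x : G) degree x = 2 * (#|G| + 2))%N by rewrite handshake eG.
  have -> : #|G| = (2 + \sum_(x in rest) 1)%N.
    by rewrite -sum1_card (sum_split2 zy).
  rewrite (sum_split2 zy).
  have -> : (degree z = 1 + \sum_(x in rest) 1)%N.
    rewrite degreeE (sum_split2 zy) sedge_irr zE //; congr (_ + _)%N.
    by apply: eq_bigr => x /andP [xz _]; rewrite zE.
  have -> : (degree y = 1 + k)%N.
    by rewrite degreeE (sum_split2 zy) sedge_irr zEC.
  have -> : (\sum_(x | (x != z) && (x != y)) degree x =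
             \sum_(x in rest) 1 + k + tau)%N.
    rewrite -!big_split; apply: eq_bigr => x /andP [xz xy] /=.
    by rewrite degreeE (sum_split2 zy) zEC // (sedge_sym x y).
  by lia.
pose A := [set x in rest | sedge y x].
have kA : k = #|A|.
  rewrite /k -sum1_card big_mkcond [RHS]big_mkcond; apply: eq_bigr => x _.
  by rewrite !inE; case: andP => //= _; case: sedge.
have restA x w : x \in rest -> w \in rest -> sedge x w -> x \in A /\ w \in A.
  move=> /andP [xz xy] /andP [wz wy] xw; rewrite !inE xz xy wz wy /=.
  by rewrite (yE x w) // (yE w x) // sedge_sym.
have AE x : x \in A = [&& x != z, x != y & sedge y x] by rewrite !inE andbA.
have [tau0|tau_gt0] := posnP tau.
  left; have nr x w : x \in rest -> w \in rest -> sedge x w = false.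
    move=> xr wr; apply/negbTE; move: tau0 => /eqP.
    rewrite sum_nat_eq0 => /forallP /(_ x); rewrite xr sum_nat_eq0 /=.
    by move=> /forallP /(_ w); rewrite wr /= eqb0.
  have : size (enum A) = 3 by rewrite -cardE; lia.
  have := enum_uniq (mem A).
  have : forall x, x \in enum A = (x \in A) by move=> x; rewrite mem_enum.
  case: (enum A) => [|a1 [|a2 [|a3 []]]] //= sA ua _.
  have [A1 A2 A3] : [/\ a1 \in A, a2 \in A & a3 \in A].
    by rewrite -!sA !inE !eqxx !orbT.
  move: (A1) (A2) (A3); rewrite !AE.
  move=> /and3P [z1 y1 e1] /and3P [z2 y2 e2] /and3P [z3 y3 e3].
  apply: (@giso_H6 _ z y a1 a2 a3) => //.
  - rewrite /= !inE !negb_or zy !(eq_sym z) z1 z2 z3 !(eq_sym y) y1 y2 y3 /=.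
    by move: ua; rewrite /= !inE negb_or.
  - move=> x w; rewrite !inE !negb_or => /and5P [xz xy x1 x2 x3] wz.
    have [->|wy] := eqVneq w y; last by apply: nr; rewrite inE ?xz ?wz.
    apply: contraNF (_ : x \notin A) => [xy'|].
      by rewrite AE xz xy sedge_sym.
    by rewrite -sA !inE !negb_or x1 x2 x3.
  by rewrite !nr // inE ?z1 ?z2 ?z3.
move: (tau_gt0); rewrite lt0n sum_nat_eq0 negb_forall => /existsP [x].
rewrite negb_imply sum_nat_eq0 negb_forall => /andP [xr /existsP [w]].
rewrite negb_imply eqb0 negbK => /andP [wr xw].
right; have [xA wA] := restA _ _ xr wr xw.
have xw' : x != w by apply: contraTneq xw => ->; rewrite sedge_irr.
have sA : [set x; w] = A.
  apply/eqP; rewrite eqEcard cards2 xw' -kA.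
  by apply/andP; split; [apply/subsetP => a /set2P [] -> | lia].
move: (xA) (wA); rewrite !AE => /and3P [xz xy yx] /and3P [wz wy yw].
apply: (@giso_H7 _ z y x w) => //; first 2 last.
- move=> a b; rewrite !inE !negb_or => /and4P [az ay ax aw] bz.
  have aA : a \notin A by rewrite -sA !inE negb_or ax aw.
  have [->|yb] := eqVneq b y.
    by apply: contraNF aA => ab; rewrite AE az ay sedge_sym.
  apply: contraNF aA => ab; have [] // := restA a b; rewrite ?inE ?az ?ay ?bz //.
- by rewrite /= !inE !negb_or zy !(eq_sym z) xz wz !(eq_sym y) xy wy xw'.
exact: leq_trans G5.
Qed.

(** * The two extremal graphs are cospectral *)

(** [K_4] on [0, 2, 3, 4] with the pendent vertex [1] attached to [0]: a copy of
    [H7 5] on the vertices of [book_graph]. *)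
Definition kite_rel (i j : 'I_5) : bool :=
  (i != j) && [|| i == ord0, j == ord0 | (1 < i) && (1 < j)]%N.

Lemma kite_sym : symmetric kite_rel.
Proof.
by move=> i j; rewrite /kite_rel eq_sym orbCA [(1 < i)%N && _]andbC.
Qed.

Lemma kite_irr : irreflexive kite_rel.
Proof. by move=> i; rewrite /kite_rel eqxx. Qed.

Definition kite_graph : sgraph := SGraph kite_sym kite_irr.

Lemma degree_attach_inl (G : sgraph) (z : G) k (x : G) :
  degree (inl x : attach_pendent z k) = (degree x + (x == z) * k)%N.
Proof.
rewrite !degreeE big_sumType /=; congr (_ + _)%N.
by rewrite sum_nat_const card_ord mulnC.
Qed.

Lemma degree_attach_inr (G : sgraph) (z : G) k (i : 'I_k) :
  degree (inr i : attach_pendent z k) = 1%N.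
Proof.
rewrite degreeE big_sumType /= [X in (_ + X)%N]big1 // addn0.
by rewrite (bigD1 z) //= eqxx big1 // => y /negPf->.
Qed.

Lemma degree_book (i : 'I_5) :
  degree (i : book_graph) = (if (i < 2) then 4 else 2)%N.
Proof.
by rewrite degreeE !big_ord_recl big_ord0; case: i => [[|[|[|[|[|//]]]]] ?].
Qed.

Lemma degree_kite (i : 'I_5) :
  degree (i : kite_graph) =
    (if i == 0 :> nat then 4 else if i == 1 :> nat then 1 else 3)%N.
Proof.
by rewrite degreeE !big_ord_recl big_ord0; case: i => [[|[|[|[|[|//]]]]] ?].
Qed.

Section Switching.
Variables (R : realType) (k : nat).
Let T : finType := ('I_5 + 'I_k)%type.

(** The matrix [J / 2 - 1] on the vertices [1, 2, 3, 4] of ['I_5], extended by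
    the identity. *)
Definition switching (x y : T) : R :=
  match x, y with
  | inl i, inl j =>
      (if (0 < i)%N && (0 < j)%N then 2^-1 else 0) +
      (if (0 < i)%N then - (i == j)%:R else (i == j)%:R)
  | inr i, inr j => (i == j)%:R
  | _, _ => 0
  end.

Lemma sum_switchingl (f : T -> R) (x : T) :
  \sum_z switching x z * f z =
  match x with
  | inl i => \sum_(j < 5) switching (inl i) (inl j) * f (inl j)
  | inr i => f x
  end.
Proof.
rewrite big_sumType /=; case: x => i /=.
  by rewrite [X in _ + X]big1 ?addr0 // => j _; rewrite mul0r.
rewrite big1 ?add0r => [|j _]; last by rewrite mul0r.
exact: (sum_delta (fun j => f (inr j))).
Qed.

Lemma switchingC (x y : T) : switching x y = switching y x.
Proof.
case: x => i; case: y => j //=; rewrite eq_sym ?(andbC (0 < i)%N) //.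
by have [->//|] := eqVneq i j; rewrite !oppr0 !if_same.
Qed.

Lemma switchingK : fun_mx switching *m fun_mx switching = 1%:M.
Proof.
rewrite mul_fun_mx -fun_mx1; apply: eq_fun_mx => x y.
rewrite sum_switchingl; case: x => [i|i]; case: y => [j|j] //; last first.
  by rewrite big1 // => l _; rewrite mulr0.
rewrite !big_ord_recl big_ord0.
by case: i j => [[|[|[|[|[|//]]]]] ?] [[|[|[|[|[|//]]]]] ?];
  rewrite /switching /= /eq_op /= /eq_op /=; lra.
Qed.

(** Since [switching] is an involution, this says that it conjugates the two
    signless Laplacians. *)
Lemma switching_book_kite :
  fun_mx switching *m fun_mx (@sl_entry R (@attach_pendent book_graph (ord0 : 'I_5) k)) =
  fun_mx (@sl_entry R (@attach_pendent kite_graph (ord0 : 'I_5) k)) *m fun_mx switching.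
Proof.
rewrite !mul_fun_mx; apply: eq_fun_mx => x y.
rewrite sum_switchingl.
under [RHS]eq_bigr do rewrite mulrC switchingC.
rewrite sum_switchingl.
case: x => [i|i]; case: y => [j|j]; last 1 first.
- by rewrite /sl_entry !degree_attach_inr.
all: rewrite ?big_ord_recl ?big_ord0 /sl_entry ?degree_attach_inl ?degree_attach_inr.
all: rewrite ?degree_book ?degree_kite.
- case: i j => [[|[|[|[|[|//]]]]] ?] [[|[|[|[|[|//]]]]] ?];
    rewrite /switching /= /eq_op /= /eq_op /= /book_rel /kite_rel /=
      ?mul1n ?mul0n ?addn0 ?(natrD _ _ k) ?mulr1n ?mulr0n; lra.
- case: i => [[|[|[|[|[|//]]]]] ?];
    rewrite /switching /= /eq_op /= /eq_op /= ?mulr1n ?mulr0n; lra.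
- case: j => [[|[|[|[|[|//]]]]] ?];
    rewrite /switching /= /eq_op /= /eq_op /= ?mulr1n ?mulr0n; lra.
Qed.

Lemma SLEE_book_kite :
  SLEE R (@attach_pendent book_graph (ord0 : 'I_5) k) =
  SLEE R (@attach_pendent kite_graph (ord0 : 'I_5) k).
Proof.
apply: eq_SLEE => j; rewrite !signless_laplacianE.
apply: (mxtrace_conjX j switchingK).
by rewrite -mulmxA -switching_book_kite mulmxA switchingK mul1mx.
Qed.

End Switching.

Lemma giso_kite_H7 n : (5 <= n)%N ->
  giso (@attach_pendent kite_graph (ord0 : 'I_5) (n - 5)) (H7 n).
Proof.
move=> n5; pose G := @attach_pendent kite_graph (ord0 : 'I_5) (n - 5).
have cG : #|G| = n by rewrite card_sum !card_ord subnKC.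
rewrite -[in H7 n]cG; pose c i (i5 : (i < 5)%N) : G := inl (Ordinal i5).
apply: (@giso_H7 G (c 0 isT) (c 2 isT) (c 3 isT) (c 4 isT)) => //.
- by rewrite cG ltnW.
- by move=> [[[|[|[|[|[|//]]]]] ?]|i].
- by move=> [[[|[|[|[|[|//]]]]] ?]|i] [[[|[|[|[|[|//]]]]] ?]|j].
Qed.

Lemma SLEE_H6_H7 (R : realType) n : (5 <= n)%N -> SLEE R (H6 n) = SLEE R (H7 n).
Proof.
by move=> n5; rewrite -(SLEE_giso R (giso_kite_H7 n5)); exact: SLEE_book_kite.
Qed.

(** * The extremal property *)

(** Induction on the room left below the bound [n * n ^ 2] on the sum of the
    squared degrees, which every strict Kelmans move increases. *)
Lemma H6_H7_extremal (R : realType) (n : nat) (G : sgraph) : (5 <= n)%N ->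
  #|G| = n -> tricyclic G ->
  (giso G (H6 n) \/ giso G (H7 n)) \/ SLEE R G < SLEE R (H6 n).
Proof.
move=> n5; pose D2 (G : sgraph) := (\sum_(x : G) degree x ^ 2)%N.
have [N] := ubnP (n * n ^ 2 - D2 G); elim: N G => // N IHN G.
rewrite ltnS => leN cG tG.
have [stG|] := boolP [forall u : G, forall v : G, forall w1 : G, forall w2 : G,
                        ~~ kelmans_movable u v w1 w2].
  left; rewrite -cG; apply: stable_tricyclic_giso => //; first by rewrite cG.
  by move=> u v w1 w2; move/forallP/(_ u)/forallP/(_ v)/forallP/(_ w1)/forallP: stG.
rewrite negb_forall => /existsP [u]; rewrite negb_forall => /existsP [v].
rewrite negb_forall => /existsP [w1]; rewrite negb_forall => /existsP [w2].
rewrite negbK => /and5P [uv nuv uw1 vw1 /and4P [w1v vw2 uw2 w2u]]; right.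
have ltG := ltr_SLEE_kelmans R uv uw1 vw1 w1v vw2 uw2 w2u.
have ltD := kelmans_sum_degree2 uv uw1 vw1 w1v vw2 uw2 w2u.
have tG' : tricyclic (kelmans uv).
  case: tG => conG eG; split; first exact: kelmans_connected.
  by rewrite kelmans_card_edges eG.
have leD : (D2 (kelmans uv) <= n * n ^ 2)%N.
  rewrite -cG -[X in (_ <= X * _)%N]/(#|kelmans uv|) -sum_nat_const.
  by apply: leq_sum => x _; rewrite leq_sqr max_card.
have ltN : (n * n ^ 2 - D2 (kelmans uv) < N)%N.
  by apply: leq_trans leN; apply: ltn_sub2l => //; exact: leq_trans leD.
have [[iso|iso]|lt6] := IHN _ ltN cG tG'.
- by rewrite -(SLEE_giso R iso).
- by rewrite SLEE_H6_H7 // -(SLEE_giso R iso).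
exact: lt_trans lt6.
Qed.

Theorem theorem2p2 (R : realType) (n : nat) (hn : (5 <= n)%N) :
  SLEE R (H6 n) = SLEE R (H7 n) /\
  forall G : sgraph, #|G| = n -> tricyclic G ->
    SLEE R G <= SLEE R (H6 n) /\
    (SLEE R G = SLEE R (H6 n) <-> giso G (H6 n) \/ giso G (H7 n)).
Proof.
split=> [|G cG tG]; first exact: SLEE_H6_H7.
have isoE : giso G (H6 n) \/ giso G (H7 n) -> SLEE R G = SLEE R (H6 n).
  by case=> iso; rewrite (SLEE_giso R iso) ?SLEE_H6_H7.
have [iso|lt6] := H6_H7_extremal R hn cG tG; first by rewrite isoE.
split; first exact: ltW.
by split=> [e|/isoE //]; rewrite e ltxx in lt6.
Qed.
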